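(* Let $n\ge 3$, $-2<l_2<l_1\le 0$, $\frac{n+l_1}{n-2}<p<q$, and suppose that $p\neq\frac{n+2+2l_1}{n-2}$ and $q\neq\frac{n+2+2l_2}{n-2}$. Let $u$ be any positive radial solution of $$\Delta u+|x|^{l_1}u^{p}+|x|^{l_2}u^{q}=0 .$$ Then either $$\lim_{r\to\infty}r^{\alpha_1}u(r)=\lambda_1\quad\text{or}\quad \lim_{r\to\infty}r^{n-2}u(r)=c_1 \text{ for some constant } c_1>0 .$$ Moreover, either $$\lim_{r\to 0}r^{\alpha_2}u(r)=\lambda_2\quad\text{or}\quad \lim_{r\to 0}u(r)=c_2\text{ for some constant } c_2>0 .$$
   Context: A positive radial solution is a function $u=u(r)$, $r=|x|$, that is $C^2$ and positive on $(0,\infty)$ and satisfies $u''+\frac{n-1}{r}u'+r^{l_1}u^p+r^{l_2}u^q=0$ for all $r\in(0,\infty)$ (so $u$ may be singular at the origin). Notation: $\alpha_1=\frac{2+l_1}{p-1}$, $\alpha_2=\frac{2+l_2}{q-1}$; $\lambda_1>0$ and $\lambda_2>0$ are defined by $\lambda_1^{p-1}=\alpha_1(n-2-\alpha_1)$ and $\lambda_2^{q-1}=\alpha_2(n-2-\alpha_2)$. (Under the hypotheses $0<\alpha_2<\alpha_1<n-2$.) *)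

(* Defs.v *)
From Stdlib Require Import Reals.
From Coquelicot Require Import Coquelicot.
Open Scope R_scope.

(* [Derive] is total, so the existence of the two derivatives has to be
   required separately. *)
Definition C2_on_pos (u : R -> R) : Prop :=
  forall r : R, 0 < r ->
    ex_derive u r /\ ex_derive (Derive u) r /\ continuous (Derive_n u 2) r.

(* Only the values of [u] on (0, +oo) matter: [u] may be singular at the
   origin.  [Rpower] is the usual real power because its bases [r] and [u r]
   are positive here. *)
Definition positive_radial_solution
    (n : nat) (l1 l2 p q : R) (u : R -> R) : Prop :=
  C2_on_pos u /\
  (forall r : R, 0 < r -> 0 < u r) /\
  (forall r : R, 0 < r ->
     Derive_n u 2 r + (INR n - 1) / r * Derive u r
       + Rpower r l1 * Rpower (u r) p + Rpower r l2 * Rpower (u r) q = 0).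

Definition alpha (l p : R) : R := (2 + l) / (p - 1).

(* [lambda^(p-1) = alpha (n - 2 - alpha)] determines [lambda > 0] uniquely
   when [p <> 1] and the right-hand side is positive. *)
Definition is_lambda (n : nat) (l p lambda : R) : Prop :=
  0 < lambda /\
  Rpower lambda (p - 1) = alpha l p * (INR n - 2 - alpha l p).

(* Main.v *)
Require Import Defs.
From Stdlib Require Import Reals Lra Lia.
From Coquelicot Require Import Coquelicot.
Open Scope R_scope.

(** Work in logarithmic time [t = ln r] near infinity, [t = - ln r] near the
    origin, and follow [x], the logarithm of [r^alpha u], where [alpha] is the
    exponent of the term that dominates at that end ([alpha_1] at infinity,
    [alpha_2] at the origin).  In both cases [v = x'] satisfies
      [v' = (a - v) (m + v) - e^(P x) - e^(Q (x - g t))]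
    with [a, m, P, Q, g > 0] and [a + m = n - 2]: inversion of time exchanges
    the roles of [a] and [m], of [p] and [q].  The last term, which comes from
    the dominated nonlinearity, carries a factor decaying exponentially.
    The criticality assumptions say exactly that [a <> m], so that the two
    halves of the theorem are one dichotomy for this flow
    ([flow_dichotomy]): either [e^(P x)] tends to the equilibrium value [a m],
    or [x + m t] converges, which means [r^(n-2) u -> c_1] at infinity and
    [u -> c_2] at the origin.

    The flow exists on the whole line, and this alone gives bounds.  Outside
    [- m < v < a] the Riccati part blows up in finite forward or backward time
    ([velocity_bounds]); as [x] cannot then drop by more than [m] in unit time,
    a large [x] would make [v] decrease by more than the width [a + m]
    ([position_bounded_above]).

    Put [w = e^x], the unknown of the Emden-Fowler equation
      [w'' + (m - a) w' - a m w + w^(P+1) + e^(-Q g t) w^(Q+1) = 0].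
    Its friction [m - a] has a sign, so the energy is monotone up to an
    integrable error and, being bounded, it converges; its dissipation is
    proportional to [w'^2], whence [w' -> 0] by Barbalat's lemma
    ([momentum_vanishes]).  A second use of that lemma gives [w'' -> 0], and
    the equation leaves [w (a m - w^P) -> 0] ([equilibrium_defect_vanishes]).
    Since [w] is continuous it must choose: [w^P -> a m] or [w -> 0]
    ([equilibrium_or_extinction]).

    When [w -> 0] the forcing dies out, and the stable manifold of the origin
    has slope [- m]: first [v] becomes negative, then less than [- m / 2]
    ([velocity_eventually_negative]), so that the forcing decays exponentially,
    and [m + v] is integrable ([extinction_rate]). *)

(** * Limits of functions controlled by their derivative *)

Lemma derive_growth (f df : R -> R) (m a b : R) :
  a <= b ->
  (forall t, a <= t <= b -> is_derive f t (df t)) ->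
  (forall t, a <= t <= b -> m <= df t) ->
  m * (b - a) <= f b - f a.
Proof.
  intros Hab Hf Hm.
  destruct (MVT_gen f a b df) as [c [Hc Heq]].
  - intros t; rewrite Rmin_left, Rmax_right by lra. intros Ht; apply Hf; lra.
  - intros t; rewrite Rmin_left, Rmax_right by lra. intros Ht.
    apply continuity_pt_filterlim, @ex_derive_continuous.
    exists (df t); apply Hf; lra.
  - rewrite Rmin_left, Rmax_right in Hc by lra.
    rewrite Heq. apply Rmult_le_compat_r; [lra | now apply Hm].
Qed.

Lemma derive_increasing (f df : R -> R) (a b : R) :
  a < b ->
  (forall t, a <= t <= b -> is_derive f t (df t)) ->
  (forall t, a <= t <= b -> 0 < df t) ->
  f a < f b.
Proof.
  intros Hab Hf Hm.
  destruct (MVT_gen f a b df) as [c [Hc Heq]].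
  - intros t; rewrite Rmin_left, Rmax_right by lra. intros Ht; apply Hf; lra.
  - intros t; rewrite Rmin_left, Rmax_right by lra. intros Ht.
    apply continuity_pt_filterlim, @ex_derive_continuous.
    exists (df t); apply Hf; lra.
  - rewrite Rmin_left, Rmax_right in Hc by lra.
    assert (0 < df c * (b - a)) by (apply Rmult_lt_0_compat; [now apply Hm | lra]).
    lra.
Qed.

Lemma exp_le (s t : R) : s <= t -> exp s <= exp t.
Proof.
  intros [Hlt | ->]; [left; now apply exp_increasing | now right].
Qed.

Lemma is_lim_finite_eps (f : R -> R) (l : R) :
  is_lim f p_infty l <->
  forall eps, 0 < eps -> exists T, forall t, T <= t -> Rabs (f t - l) < eps.
Proof.
  rewrite <- is_lim_spec; split.
  - intros H eps Heps. destruct (H (mkposreal eps Heps)) as [T HT].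
    exists (T + 1). intros t Ht. apply HT; lra.
  - intros H eps. destruct (H eps (cond_pos eps)) as [T HT].
    exists T. intros t Ht. apply HT; lra.
Qed.

Lemma nondecreasing_bounded_ex_lim (f : R -> R) (T K : R) :
  (forall s t, T <= s -> s <= t -> f s <= f t) ->
  (forall t, T <= t -> f t <= K) ->
  exists l : R, is_lim f p_infty l.
Proof.
  intros Hmono Hbd.
  destruct (completeness (fun y => exists t, T <= t /\ y = f t)) as [l [Hub Hlub]].
  - exists K. intros y [t [Ht ->]]. now apply Hbd.
  - exists (f T), T. split; [lra | reflexivity].
  - exists l. apply is_lim_finite_eps. intros eps Heps.
    assert (Hex : exists s, T <= s /\ l - eps < f s).
    { apply Classical_Prop.NNPP. intros Hno.
      assert (l <= l - eps); [| lra].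
      apply Hlub. intros y [t [Ht ->]].
      apply Rnot_lt_le. intros Hlt. apply Hno. now exists t. }
    destruct Hex as [s [Hs1 Hs2]].
    exists s. intros t Ht.
    assert (f s <= f t) by (apply Hmono; lra).
    assert (f t <= l) by (apply Hub; exists t; split; [lra | reflexivity]).
    apply Rabs_def1; lra.
Qed.

Definition bounded_forward (f : R -> R) : Prop :=
  exists K, forall t, 0 <= t -> Rabs (f t) <= K.

Lemma bounded_forward_const (c : R) : bounded_forward (fun _ => c).
Proof. exists (Rabs c). intros; lra. Qed.

Lemma bounded_forward_plus (f g : R -> R) :
  bounded_forward f -> bounded_forward g ->
  bounded_forward (fun t => f t + g t).
Proof.
  intros [K HK] [M HM]. exists (K + M). intros t Ht.
  generalize (Rabs_triang (f t) (g t)) (HK t Ht) (HM t Ht). lra.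
Qed.

Lemma bounded_forward_minus (f g : R -> R) :
  bounded_forward f -> bounded_forward g ->
  bounded_forward (fun t => f t - g t).
Proof.
  intros [K HK] [M HM]. exists (K + M). intros t Ht.
  generalize (Rabs_triang (f t) (- g t)) (HK t Ht) (HM t Ht).
  rewrite Rabs_Ropp. unfold Rminus. lra.
Qed.

Lemma bounded_forward_mult (f g : R -> R) :
  bounded_forward f -> bounded_forward g ->
  bounded_forward (fun t => f t * g t).
Proof.
  intros [K HK] [M HM]. exists (K * M). intros t Ht.
  rewrite Rabs_mult.
  apply Rmult_le_compat; auto using Rabs_pos.
Qed.

Lemma is_lim_0_mult_bounded (f g : R -> R) :
  is_lim f p_infty 0 -> bounded_forward g ->
  is_lim (fun t => f t * g t) p_infty 0.
Proof.
  rewrite !is_lim_finite_eps. intros Hf [K HK] eps Heps.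
  assert (HK0 : 0 < Rabs K + 1) by (generalize (Rabs_pos K); lra).
  destruct (Hf (eps / (Rabs K + 1))) as [T HT].
  { now apply Rdiv_lt_0_compat. }
  exists (Rmax T 0). intros t Ht.
  assert (Hf' := HT t (Rle_trans _ _ _ (Rmax_l T 0) Ht)).
  assert (HK' := HK t (Rle_trans _ _ _ (Rmax_r T 0) Ht)).
  rewrite Rminus_0_r in *. rewrite Rabs_mult.
  apply Rle_lt_trans with (Rabs (f t) * (Rabs K + 1)).
  - apply Rmult_le_compat_l; [apply Rabs_pos |].
    generalize (Rle_abs K). lra.
  - replace eps with (eps / (Rabs K + 1) * (Rabs K + 1)) by (field; lra).
    now apply Rmult_lt_compat_r.
Qed.

(** Barbalat's lemma in one-sided form: if [h] reached [eps] at a late time, it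
    would stay above [eps / 2] for a time independent of that moment, since [h]
    is Lipschitz; [f] would then gain a fixed amount, although it
    converges. *)
Lemma barbalat_limsup (f df h dh : R -> R) (l : R) :
  (forall t, is_derive f t (df t)) ->
  (forall t, is_derive h t (dh t)) ->
  bounded_forward dh ->
  (forall t, 0 <= t -> h t <= df t) ->
  is_lim f p_infty l ->
  forall eps, 0 < eps -> exists T, forall t, T <= t -> h t < eps.
Proof.
  intros Hf Hh [K HK] Hle Hlim eps Heps.
  set (L := Rabs K + 1).
  assert (HL : 0 < L) by (unfold L; generalize (Rabs_pos K); lra).
  set (eta := eps / (2 * L)).
  assert (Heta : 0 < eta) by (apply Rdiv_lt_0_compat; lra).
  assert (HLeta : L * eta = eps / 2) by (unfold eta; field; lra).
  rewrite is_lim_finite_eps in Hlim.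
  destruct (Hlim (eps * eta / 8)) as [T HT].
  { apply Rdiv_lt_0_compat; [now apply Rmult_lt_0_compat | lra]. }
  exists (Rmax T 0). intros t Ht.
  assert (HtT := Rle_trans _ _ _ (Rmax_l T 0) Ht).
  assert (Ht0 := Rle_trans _ _ _ (Rmax_r T 0) Ht).
  apply Rnot_le_lt. intros Hbig.
  assert (Hstay : forall s, t <= s <= t + eta -> eps / 2 <= df s).
  { intros s Hs. apply Rle_trans with (h s); [| apply Hle; lra].
    assert (- L * (s - t) <= h s - h t).
    { apply derive_growth with dh; [lra | intros; apply Hh |].
      intros r Hr. assert (HKr := HK r ltac:(lra)).
      apply Rabs_le_between in HKr. generalize (Rle_abs K). unfold L. lra. }
    assert (L * (s - t) <= L * eta) by (apply Rmult_le_compat_l; lra).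
    lra. }
  assert (Hgain := derive_growth f df (eps / 2) t (t + eta) ltac:(lra)
                     (fun s _ => Hf s) Hstay).
  assert (H1 := HT t HtT). assert (H2 := HT (t + eta) ltac:(lra)).
  apply Rabs_lt_between in H1. apply Rabs_lt_between in H2.
  assert (0 < eps * eta) by now apply Rmult_lt_0_compat.
  lra.
Qed.

Lemma barbalat (f df ddf : R -> R) (l : R) :
  (forall t, is_derive f t (df t)) ->
  (forall t, is_derive df t (ddf t)) ->
  bounded_forward ddf ->
  is_lim f p_infty l ->
  is_lim df p_infty 0.
Proof.
  intros Hf Hdf Hb Hlim. apply is_lim_finite_eps. intros eps Heps.
  destruct (barbalat_limsup f df df ddf l) with (eps := eps) as [T1 HT1];
    auto using Rle_refl.
  destruct (barbalat_limsup (fun t => - f t) (fun t => - df t)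
              (fun t => - df t) (fun t => - ddf t) (- l))
    with (eps := eps) as [T2 HT2]; auto using Rle_refl.
  - intros t. apply @is_derive_opp with (l := df t). apply Hf.
  - intros t. apply @is_derive_opp with (l := ddf t). apply Hdf.
  - destruct Hb as [K HK]. exists K. intros t Ht. rewrite Rabs_Ropp. now apply HK.
  - now apply (is_lim_opp f p_infty l).
  - exists (Rmax T1 T2). intros t Ht. rewrite Rminus_0_r.
    assert (H1 := HT1 t (Rle_trans _ _ _ (Rmax_l T1 T2) Ht)).
    assert (H2 := HT2 t (Rle_trans _ _ _ (Rmax_r T1 T2) Ht)).
    apply Rabs_def1; lra.
Qed.

(** * A priori bounds for the flow *)

Definition emden_fowler_flow (a m P Q g : R) (x v : R -> R) : Prop :=
  (forall t, is_derive x t (v t)) /\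
  (forall t, is_derive v t
     ((a - v t) * (m + v t) - exp (P * x t) - exp (Q * (x t - g * t)))).

Ltac flow_derive Hx Hv :=
  auto_derive;
  [ repeat match goal with
    | |- _ /\ _ => split
    | |- True => exact I
    | |- ex_derive (fun s => ?f s) _ =>
        match type of Hx with
        | forall t, is_derive f _ _ => eexists; apply Hx
        end
    | |- ex_derive (fun s => ?f s) _ => eexists; apply Hv
    end
  | rewrite ?(fun s => is_derive_unique _ _ _ (Hx s)),
      ?(fun s => is_derive_unique _ _ _ (Hv s));
    unfold Rminus ].

(** If [y = - m - v] is nonnegative at some time then it is positive ever after,
    because [y e^(x - a t)] increases (for [x = a t + ln u], this is the function
    [- ((n - 2) u + r u')]).  The Riccati inequality [y' > y^2] then
    forces blow-up: [- 1 / y] is negative but grows faster than [t]. *)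
Lemma velocity_lower_bound (a m : R) (x v dv : R -> R) :
  0 < a + m ->
  (forall t, is_derive x t (v t)) ->
  (forall t, is_derive v t (dv t)) ->
  (forall t, dv t < (a - v t) * (m + v t)) ->
  forall t, - m < v t.
Proof.
  intros Ham Hx Hv Hdv t0. apply Rnot_le_lt. intros Hle.
  set (f := fun t => (- m - v t) * exp (x t - a * t)).
  set (df := fun t => ((a - v t) * (m + v t) - dv t) * exp (x t - a * t)).
  assert (Hf : forall t, is_derive f t (df t)).
  { intros t. unfold f, df. flow_derive Hx Hv. ring. }
  assert (Hneg : forall t, t0 < t -> 0 < - m - v t).
  { intros t Ht.
    assert (Hlt : f t0 < f t).
    { apply derive_increasing with df; [assumption | intros; apply Hf |].
      intros s _. unfold df. apply Rmult_lt_0_compat; [| apply exp_pos].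
      generalize (Hdv s). lra. }
    assert (0 <= f t0).
    { unfold f. apply Rmult_le_pos; [lra | left; apply exp_pos]. }
    apply Rmult_lt_reg_r with (exp (x t - a * t)); [apply exp_pos |].
    unfold f in *. lra. }
  set (t1 := t0 + 1).
  assert (H1 := Hneg t1 ltac:(unfold t1; lra)).
  set (y1 := - m - v t1) in *.
  assert (Hy1 : 0 < / y1) by now apply Rinv_0_lt_compat.
  assert (Hgrow := derive_growth (fun t => - / (- m - v t))
    (fun t => - dv t / (- m - v t) ^ 2) 1 t1 (t1 + / y1) ltac:(lra)).
  assert (Hend := Hneg (t1 + / y1) ltac:(unfold t1; lra)).
  apply Rinv_0_lt_compat in Hend. cbv beta in Hgrow.
  fold y1 in Hgrow. enough (1 * (t1 + / y1 - t1) <= - / (- m - v (t1 + / y1)) - - / y1) by lra.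
  apply Hgrow.
  - intros t Ht. assert (Hyt := Hneg t ltac:(unfold t1 in *; lra)).
    flow_derive Hx Hv; [lra | field; lra].
  - intros t Ht. assert (Hyt := Hneg t ltac:(unfold t1 in *; lra)).
    apply Rmult_le_reg_r with ((- m - v t) ^ 2); [now apply pow_lt |].
    replace (- dv t / (- m - v t) ^ 2 * (- m - v t) ^ 2) with (- dv t) by (field; lra).
    generalize (Hdv t). nra.
Qed.

(** The upper bound is the lower bound for the time-reversed motion, in which
    [v] becomes [- v] and [a], [m] are exchanged. *)
Lemma velocity_bounds (a m P Q g : R) (x v : R -> R) :
  0 < a -> 0 < m -> emden_fowler_flow a m P Q g x v ->
  forall t, - m < v t < a.
Proof.
  intros Ha Hm [Hx Hv].
  set (dv := fun t => (a - v t) * (m + v t) - exp (P * x t) - exp (Q * (x t - g * t))).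
  assert (Hdv : forall t, dv t < (a - v t) * (m + v t)).
  { intros t. unfold dv. generalize (exp_pos (P * x t)) (exp_pos (Q * (x t - g * t))). lra. }
  intros t; split.
  - apply (velocity_lower_bound a m x v dv); auto; lra.
  - rewrite <- (Ropp_involutive t).
    enough (- a < - v (- - t)) by lra.
    apply (velocity_lower_bound m a (fun s => x (- s)) (fun s => - v (- s))
             (fun s => dv (- s))); [lra | | |].
    + intros s. flow_derive Hx Hv.  ring.
    + intros s. flow_derive Hx Hv. unfold dv, Rminus. ring.
    + intros s. generalize (Hdv (- s)). lra.
Qed.

(** Since [v > - m], a large value of [x] persists on a unit time interval; the
    forcing [e^(P x)] would then push [v] down by more than [a + m], the
    width of the interval to which [v] is confined. *)
Lemma position_bounded_above (a m P Q g : R) (x v : R -> R) :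
  0 < a -> 0 < m -> 0 < P -> emden_fowler_flow a m P Q g x v ->
  exists K, forall t, x t <= K.
Proof.
  intros Ha Hm HP Hflow.
  assert (Hb := velocity_bounds a m P Q g x v Ha Hm Hflow).
  destruct Hflow as [Hx Hv].
  (* [(a + m)^2] dominates [(a - v) (m + v)], and the second [a + m] is the
     decrease of [v] to be reached *)
  set (M := (a + m) ^ 2 + (a + m)).
  assert (HM : 0 < M) by (unfold M; nra).
  exists (m + ln M / P). intros t0.
  assert (Hdrop : forall t, t0 <= t <= t0 + 1 -> x t0 - m <= x t).
  { intros t Ht.
    assert (- m * (t - t0) <= x t - x t0).
    { apply derive_growth with v; [lra | intros; apply Hx |].
      intros s _. generalize (Hb s). lra. }
    nra. }
  apply Rnot_lt_le. intros Hlt.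
  assert (Hbig : forall t, t0 <= t <= t0 + 1 -> M <= exp (P * x t)).
  { intros t Ht. rewrite <- (exp_ln M HM).
    assert (ln M = P * (ln M / P)) by (field; lra).
    assert (P * (ln M / P) <= P * x t).
    { apply Rmult_le_compat_l; [lra |]. generalize (Hdrop t Ht). lra. }
    apply exp_le. lra. }
  assert (Hgain := derive_growth (fun t => - v t) (fun t => - ((a - v t) * (m + v t)
      - exp (P * x t) - exp (Q * (x t - g * t)))) (a + m) t0 (t0 + 1) ltac:(lra)).
  assert (Hb0 := Hb t0). assert (Hb1 := Hb (t0 + 1)).
  enough ((a + m) * (t0 + 1 - t0) <= - v (t0 + 1) - - v t0) by lra.
  apply Hgain.
  - intros t _. apply @is_derive_opp with (l := _ : R). apply Hv.
  - intros t Ht. generalize (Hbig t Ht) (exp_pos (Q * (x t - g * t))) (Hb t).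
    unfold M. nra.
Qed.

(** * Relaxation to a zero of the nonlinearity *)

Lemma is_lim_exp_decay (c : R) : 0 < c -> is_lim (fun t => exp (- (c * t))) p_infty 0.
Proof.
  intros Hc. apply is_lim_finite_eps. intros eps Heps.
  exists (1 - ln eps / c). intros t Ht.
  rewrite Rminus_0_r, Rabs_pos_eq by (left; apply exp_pos).
  rewrite <- (exp_ln eps Heps). apply exp_increasing.
  assert (c * (1 - ln eps / c) <= c * t) by (apply Rmult_le_compat_l; lra).
  replace (c * (1 - ln eps / c)) with (c - ln eps) in * by (field; lra).
  lra.
Qed.

Lemma flow_bounded (a m P Q g : R) (x v : R -> R) :
  0 < a -> 0 < m -> 0 < P -> 0 < Q -> 0 < g ->
  emden_fowler_flow a m P Q g x v ->
  bounded_forward v /\ bounded_forward (fun t => exp (x t)) /\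
  bounded_forward (fun t => exp (P * x t)) /\
  bounded_forward (fun t => exp (Q * (x t - g * t))).
Proof.
  intros Ha Hm HP HQ Hg Hflow.
  assert (Hb := velocity_bounds a m P Q g x v Ha Hm Hflow).
  destruct (position_bounded_above a m P Q g x v Ha Hm HP Hflow) as [K HK].
  repeat split.
  - exists (a + m). intros t _. apply Rabs_le. generalize (Hb t). lra.
  - exists (exp K). intros t _.
    rewrite Rabs_pos_eq by (left; apply exp_pos). now apply exp_le.
  - exists (exp (P * K)). intros t _.
    rewrite Rabs_pos_eq by (left; apply exp_pos). apply exp_le.
    now apply Rmult_le_compat_l; [lra |].
  - exists (exp (Q * K)). intros t Ht.
    rewrite Rabs_pos_eq by (left; apply exp_pos). apply exp_le.
    apply Rmult_le_compat_l; [lra |].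
    assert (0 <= g * t) by (apply Rmult_le_pos; lra).
    generalize (HK t). lra.
Qed.

Ltac flow_bounded_tac :=
  repeat first
    [ assumption
    | apply bounded_forward_minus
    | apply bounded_forward_plus
    | apply bounded_forward_mult
    | apply bounded_forward_const ].

Lemma perturbation_vanishes (a m P Q g : R) (x v : R -> R) :
  0 < a -> 0 < m -> 0 < P -> 0 < Q -> 0 < g ->
  emden_fowler_flow a m P Q g x v ->
  is_lim (fun t => exp (Q * (x t - g * t))) p_infty 0.
Proof.
  intros Ha Hm HP HQ Hg Hflow.
  destruct (position_bounded_above a m P Q g x v Ha Hm HP Hflow) as [K HK].
  apply is_lim_ext with (fun t => exp (- (Q * g * t)) * exp (Q * x t)).
  { intros t. rewrite <- exp_plus. f_equal. ring. }
  apply is_lim_0_mult_bounded.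
  - apply is_lim_exp_decay. now apply Rmult_lt_0_compat.
  - exists (exp (Q * K)). intros t _.
    rewrite Rabs_pos_eq by (left; apply exp_pos). apply exp_le.
    now apply Rmult_le_compat_l; [lra |].
Qed.

(** The energy [E = w'^2 / 2 - a m w^2 / 2 + w^(P+2) / (P+2)
    + e^(-Q g t) w^(Q+2) / (Q+2)], where [w = e^x] and [w' = w v], satisfies
    [E' = (a - m) w'^2 - (Q g / (Q+2)) w^2 e^(Q (x - g t))].  Corrected by a
    multiple of [e^(-Q g t)] when the two terms have opposite signs, and divided
    by [a - m], it is bounded and its derivative dominates [w'^2]. *)
Lemma momentum_vanishes (a m P Q g : R) (x v : R -> R) :
  0 < a -> 0 < m -> a <> m -> 0 < P -> 0 < Q -> 0 < g ->
  emden_fowler_flow a m P Q g x v ->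
  is_lim (fun t => exp (x t) * v t) p_infty 0.
Proof.
  intros Ha Hm Ham HP HQ Hg Hflow.
  destruct (flow_bounded a m P Q g x v) as [Bv [Bw [BX BY]]]; auto.
  destruct (position_bounded_above a m P Q g x v Ha Hm HP Hflow) as [K HK].
  destruct Hflow as [Hx Hv].
  set (w := fun t => exp (x t)) in *.
  set (X := fun t => exp (P * x t)) in *.
  set (Y := fun t => exp (Q * (x t - g * t))) in *.
  (* for [a < m] both terms of [E'] have the same sign and [D = 0] will do; for
     [m < a], [D] comes from the upper bound [K] of [x] *)
  assert (HD : exists D, forall t,
    0 <= (D * exp (- (Q * g * t)) - w t ^ 2 * Y t / (Q + 2)) / (a - m)).
  { destruct (Rlt_le_dec a m) as [Hlt | Hle].
    - exists 0. intros t.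
      assert (0 <= w t ^ 2 * Y t / (Q + 2)).
      { apply Rmult_le_pos; [| left; apply Rinv_0_lt_compat; lra].
        apply Rmult_le_pos; [apply pow2_ge_0 | left; apply exp_pos]. }
      replace ((0 * exp (- (Q * g * t)) - w t ^ 2 * Y t / (Q + 2)) / (a - m))
        with (w t ^ 2 * Y t / (Q + 2) * / (m - a)) by (field; lra).
      apply Rmult_le_pos; [assumption | left; apply Rinv_0_lt_compat; lra].
    - exists (exp ((Q + 2) * K) / (Q + 2)). intros t.
      apply Rmult_le_pos; [| left; apply Rinv_0_lt_compat; lra].
      enough (w t ^ 2 * Y t <= exp ((Q + 2) * K) * exp (- (Q * g * t))).
      { replace (exp ((Q + 2) * K) / (Q + 2) * exp (- (Q * g * t))
                 - w t ^ 2 * Y t / (Q + 2))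
          with ((exp ((Q + 2) * K) * exp (- (Q * g * t)) - w t ^ 2 * Y t) * / (Q + 2))
          by (field; lra).
        apply Rmult_le_pos; [lra | left; apply Rinv_0_lt_compat; lra]. }
      unfold w, Y. simpl pow. rewrite Rmult_1_r, <- !exp_plus. apply exp_le.
      assert ((Q + 2) * x t <= (Q + 2) * K) by (apply Rmult_le_compat_l; auto; lra).
      lra. }
  destruct HD as [D HD].
  set (E := fun t => w t ^ 2 * (v t ^ 2 / 2 - a * m / 2 + X t / (P + 2) + Y t / (Q + 2))).
  set (f := fun t => (E t - D * exp (- (Q * g * t))) / (a - m)).
  set (df := fun t => w t ^ 2 * v t ^ 2
     + Q * g * ((D * exp (- (Q * g * t)) - w t ^ 2 * Y t / (Q + 2)) / (a - m))).
  assert (Hf : forall t, is_derive f t (df t)).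
  { intros t. unfold f, df, E, w, X, Y. flow_derive Hx Hv. field. lra. }
  assert (Hdf : forall t, w t ^ 2 * v t ^ 2 <= df t).
  { intros t. unfold df.
    assert (0 < Q * g) by now apply Rmult_lt_0_compat.
    generalize (Rmult_le_pos (Q * g) _ ltac:(lra) (HD t)). lra. }
  assert (Hlim : exists l : R, is_lim f p_infty l).
  { assert (Bf : bounded_forward f).
    { assert (BE : bounded_forward (fun t => exp (- (Q * g * t)))).
      { exists 1. intros t Ht. rewrite Rabs_pos_eq by (left; apply exp_pos).
        rewrite <- exp_0. apply exp_le.
        assert (0 <= Q * g * t) by (repeat apply Rmult_le_pos; lra). lra. }
      unfold f, E, Rdiv, pow. flow_bounded_tac. }
    destruct Bf as [M HM].
    apply nondecreasing_bounded_ex_lim with 0 M.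
    - intros s t Hs Hst.
      enough (0 * (t - s) <= f t - f s) by lra.
      apply derive_growth with df; auto. intros r _.
      apply Rle_trans with (2 := Hdf r).
      rewrite <- Rpow_mult_distr. apply pow2_ge_0.
    - intros t Ht. generalize (HM t Ht) (Rle_abs (f t)). lra. }
  destruct Hlim as [l Hl].
  set (dh := fun t => 2 * (w t * v t) *
     (w t * (v t * v t + ((a - v t) * (m + v t) - X t - Y t)))).
  apply is_lim_finite_eps. intros eps Heps.
  destruct (barbalat_limsup f df (fun t => w t ^ 2 * v t ^ 2) dh l)
    with (eps := eps ^ 2) as [T HT]; auto.
  - intros t. unfold dh, w, X, Y. flow_derive Hx Hv. ring.
  - unfold dh. flow_bounded_tac.
  - now apply pow_lt.
  - exists T. intros t Ht. rewrite Rminus_0_r.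
    rewrite <- (Rabs_pos_eq eps) by lra.
    apply Rsqr_lt_abs_0. unfold Rsqr.
    generalize (HT t Ht). unfold w. intros H. nra.
Qed.

(** Barbalat's lemma applied to [w' = w v -> 0] gives [w'' -> 0]; all the other
    terms of the second-order equation for [w] are already known to vanish. *)
Lemma equilibrium_defect_vanishes (a m P Q g : R) (x v : R -> R) :
  0 < a -> 0 < m -> a <> m -> 0 < P -> 0 < Q -> 0 < g ->
  emden_fowler_flow a m P Q g x v ->
  is_lim (fun t => exp (x t) * (a * m - exp (P * x t))) p_infty 0.
Proof.
  intros Ha Hm Ham HP HQ Hg Hflow.
  assert (Hk := momentum_vanishes a m P Q g x v Ha Hm Ham HP HQ Hg Hflow).
  assert (HY := perturbation_vanishes a m P Q g x v Ha Hm HP HQ Hg Hflow).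
  destruct (flow_bounded a m P Q g x v) as [Bv [Bw [BX BY]]]; auto.
  destruct Hflow as [Hx Hv].
  set (dk := fun t => exp (x t) * (a * m + (a - m) * v t - exp (P * x t)
     - exp (Q * (x t - g * t)))).
  assert (Hdk : is_lim dk p_infty 0).
  { apply barbalat with (f := fun t => exp (x t) * v t) (l := 0)
      (ddf := fun t => exp (x t) *
         (v t * (a * m + (a - m) * v t - exp (P * x t) - exp (Q * (x t - g * t)))
          + ((a - m) * ((a - v t) * (m + v t) - exp (P * x t) - exp (Q * (x t - g * t)))
             - P * v t * exp (P * x t)
             - Q * (v t - g) * exp (Q * (x t - g * t))))); auto.
    - intros t. unfold dk. flow_derive Hx Hv. ring.
    - intros t. unfold dk. flow_derive Hx Hv. ring.
    - flow_bounded_tac. }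
  assert (Hk' := is_lim_0_mult_bounded _ _ Hk (bounded_forward_const (a - m))).
  assert (HY' := is_lim_0_mult_bounded _ _ HY Bw).
  apply is_lim_ext with (fun t => dk t - exp (x t) * v t * (a - m)
    + exp (Q * (x t - g * t)) * exp (x t)).
  { intros t. unfold dk. ring. }
  replace (Finite 0) with (Finite (0 - 0 + 0)) by (f_equal; ring).
  apply is_lim_plus'; [apply is_lim_minus' |]; assumption.
Qed.

(** * The dichotomy *)

Lemma eventually_on_one_side (x v : R -> R) (c T : R) :
  (forall t, is_derive x t (v t)) ->
  (forall t, T <= t -> x t <> c) ->
  (forall t, T <= t -> x t < c) \/ (forall t, T <= t -> c < x t).
Proof.
  intros Hx Hc.
  assert (Hcont : continuity x).
  { intros t. apply continuity_pt_filterlim, @ex_derive_continuous.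
    exists (v t). apply Hx. }
  assert (Hsame : forall t, T <= t -> ~ (Rmin (x T) (x t) <= c <= Rmax (x T) (x t))).
  { intros t Ht Hbetween.
    destruct (IVT_gen x T t c Hcont Hbetween) as [s [Hs Hxs]].
    apply (Hc s); [rewrite Rmin_left in Hs by lra; lra | assumption]. }
  destruct (Rtotal_order (x T) c) as [Hlt | [Heq | Hgt]].
  - left. intros t Ht. apply Rnot_le_lt. intros Hle. apply (Hsame t Ht).
    rewrite Rmin_left, Rmax_right by lra. lra.
  - exfalso. apply (Hc T); [lra | assumption].
  - right. intros t Ht. apply Rnot_le_lt. intros Hle. apply (Hsame t Ht).
    rewrite Rmin_right, Rmax_left by lra. lra.
Qed.

(** The defect [w (a m - w^P)] is bounded away from zero when [x] equals a level
    [c] below the equilibrium, so [x] eventually stays on one side of [c].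
    Above [c] the factor [w] can be divided out of the vanishing defect, below
    [c] the other factor can. *)
Lemma equilibrium_or_extinction (a m P Q g : R) (x v : R -> R) :
  0 < a -> 0 < m -> a <> m -> 0 < P -> 0 < Q -> 0 < g ->
  emden_fowler_flow a m P Q g x v ->
  is_lim (fun t => exp (P * x t)) p_infty (a * m) \/
  is_lim (fun t => exp (x t)) p_infty 0.
Proof.
  intros Ha Hm Ham HP HQ Hg Hflow.
  assert (Hdef := equilibrium_defect_vanishes a m P Q g x v Ha Hm Ham HP HQ Hg Hflow).
  assert (HB : 0 < a * m) by now apply Rmult_lt_0_compat.
  (* [ln (a m) / P] is the equilibrium; any lower level would do *)
  set (c := ln (a * m) / P - 1).
  assert (HXc : exp (P * c) = a * m * exp (- P)).
  { rewrite <- (exp_ln _ HB), <- exp_plus. f_equal.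
    unfold c. field. lra. }
  assert (HP1 : exp (- P) < 1).
  { rewrite <- exp_0. apply exp_increasing. lra. }
  set (d := a * m * (1 - exp (- P))).
  assert (Hd : 0 < d) by (apply Rmult_lt_0_compat; lra).
  assert (Hne : exists T, forall t, T <= t -> x t <> c).
  { destruct (proj1 (is_lim_finite_eps _ _) Hdef (exp c * d)) as [T HT].
    { apply Rmult_lt_0_compat; [apply exp_pos | assumption]. }
    exists T. intros t Ht Heq. specialize (HT t Ht).
    rewrite Heq, HXc in HT.
    replace (exp c * (a * m - a * m * exp (- P)) - 0) with (exp c * d) in HT
      by (unfold d; ring).
    rewrite Rabs_pos_eq in HT; [lra |].
    apply Rmult_le_pos; [left; apply exp_pos | lra]. }
  destruct Hne as [T HT].
  destruct (eventually_on_one_side x v c T (proj1 Hflow) HT) as [Hside | Hside].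
  - right. apply is_lim_finite_eps. intros eps Heps.
    destruct (proj1 (is_lim_finite_eps _ _) Hdef (eps * d)) as [T' HT'].
    { now apply Rmult_lt_0_compat. }
    exists (Rmax T T'). intros t Ht.
    assert (HtT := Rle_trans _ _ _ (Rmax_l T T') Ht).
    assert (HtT' := Rle_trans _ _ _ (Rmax_r T T') Ht).
    assert (HXt : exp (P * x t) <= exp (P * c)).
    { apply exp_le, Rmult_le_compat_l; [lra |]. left. now apply Hside. }
    specialize (HT' t HtT'). rewrite Rminus_0_r in *.
    apply Rabs_lt_between in HT'.
    rewrite Rabs_pos_eq by (left; apply exp_pos).
    apply Rmult_lt_reg_r with d; [assumption |].
    apply Rle_lt_trans with (2 := proj2 HT').
    apply Rmult_le_compat_l; [left; apply exp_pos |].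
    unfold d. lra.
  - left. apply is_lim_finite_eps. intros eps Heps.
    destruct (proj1 (is_lim_finite_eps _ _) Hdef (eps * exp c)) as [T' HT'].
    { apply Rmult_lt_0_compat; [assumption | apply exp_pos]. }
    exists (Rmax T T'). intros t Ht.
    assert (HtT := Rle_trans _ _ _ (Rmax_l T T') Ht).
    assert (HtT' := Rle_trans _ _ _ (Rmax_r T T') Ht).
    assert (Hwt : exp c <= exp (x t)) by (apply exp_le; left; now apply Hside).
    specialize (HT' t HtT'). rewrite Rminus_0_r, Rabs_mult in HT'.
    rewrite (Rabs_pos_eq (exp (x t))) in HT' by (left; apply exp_pos).
    rewrite Rabs_minus_sym.
    apply Rmult_lt_reg_r with (exp c); [apply exp_pos |].
    apply Rle_lt_trans with (2 := HT').
    rewrite Rmult_comm. apply Rmult_le_compat_r; [apply Rabs_pos | assumption].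
Qed.

Lemma extinction_forcing_vanishes (P : R) (x : R -> R) :
  0 < P -> is_lim (fun t => exp (x t)) p_infty 0 ->
  is_lim (fun t => exp (P * x t)) p_infty 0.
Proof.
  intros HP Hw. apply is_lim_finite_eps. intros eps Heps.
  destruct (proj1 (is_lim_finite_eps _ _) Hw (exp (ln eps / P))) as [T HT].
  { apply exp_pos. }
  exists T. intros t Ht. specialize (HT t Ht). rewrite Rminus_0_r in *.
  rewrite Rabs_pos_eq in * by (left; apply exp_pos).
  apply exp_lt_inv in HT. rewrite <- (exp_ln eps Heps). apply exp_increasing.
  replace (ln eps) with (P * (ln eps / P)) by (field; lra).
  now apply Rmult_lt_compat_l.
Qed.

(** Once the forcing is small, [v' > 0] on the whole range [- m / 2 <= v <= 0], so
    each level [- c] of this range can only be crossed upwards.  Above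
    [0], [x] would not decrease and could not tend to [- oo]; a [v] above
    [- m / 2] would be driven to [0] in finite time. *)
Lemma velocity_eventually_negative (a m P Q g : R) (x v : R -> R) :
  0 < a -> 0 < m -> 0 < P -> 0 < Q -> 0 < g ->
  emden_fowler_flow a m P Q g x v ->
  is_lim (fun t => exp (x t)) p_infty 0 ->
  exists T, forall t, T <= t -> v t < - (m / 2).
Proof.
  intros Ha Hm HP HQ Hg Hflow Hw.
  assert (HF : is_lim (fun t => exp (P * x t) + exp (Q * (x t - g * t))) p_infty 0).
  { replace (Finite 0) with (Finite (0 + 0)) by (f_equal; ring).
    apply is_lim_plus'.
    - now apply extinction_forcing_vanishes.
    - now apply (perturbation_vanishes a m P Q g x v). }
  assert (Hb := velocity_bounds a m P Q g x v Ha Hm Hflow).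
  destruct Hflow as [Hx Hv].
  set (d := a * m / 4).
  assert (Hd : 0 < d) by (unfold d; nra).
  destruct (proj1 (is_lim_finite_eps _ _) HF d Hd) as [T HT].
  assert (HFd : forall t, T <= t -> exp (P * x t) + exp (Q * (x t - g * t)) < d).
  { intros t Ht. specialize (HT t Ht). apply Rabs_lt_between in HT. lra. }
  assert (Hbarrier : forall c t0, 0 <= c <= m / 2 -> T <= t0 -> - c <= v t0 ->
            forall t, t0 <= t -> - c <= v t).
  { intros c t0 Hc Ht0 Hvt0 t Ht.
    (* in terms of [y = v + c] the unforced equation reads
       [y' = (a + c) (m - c) + (a - m + c - v) y]; the weight is the
       integrating factor of its second term *)
    set (f := fun t => (v t + c) * exp (x t + (m - a - c) * t)).
    set (df := fun t => ((a + c) * (m - c) - exp (P * x t) - exp (Q * (x t - g * t)))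
                        * exp (x t + (m - a - c) * t)).
    assert (Hgrow : 0 * (t - t0) <= f t - f t0).
    { apply derive_growth with df; [assumption | |].
      - intros s _. unfold f, df. flow_derive Hx Hv. ring.
      - intros s Hs. unfold df. apply Rmult_le_pos; [| left; apply exp_pos].
        generalize (HFd s ltac:(lra)). unfold d. nra. }
    assert (0 <= f t0) by (apply Rmult_le_pos; [lra | left; apply exp_pos]).
    assert (0 <= v t + c).
    { apply Rmult_le_reg_r with (exp (x t + (m - a - c) * t)); [apply exp_pos |].
      unfold f in *. lra. }
    lra. }
  assert (Hneg : forall t, T <= t -> v t < 0).
  { intros t Ht. apply Rnot_le_lt. intros Hvt.
    assert (Hinc := Hbarrier 0 t ltac:(lra) Ht ltac:(lra)).
    destruct (proj1 (is_lim_finite_eps _ _) Hw (exp (x t)) (exp_pos _)) as [T2 HT2].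
    specialize (HT2 (Rmax t T2) (Rmax_r _ _)).
    rewrite Rminus_0_r, Rabs_pos_eq in HT2 by (left; apply exp_pos).
    apply exp_lt_inv in HT2.
    assert (0 * (Rmax t T2 - t) <= x (Rmax t T2) - x t).
    { apply derive_growth with v; [apply Rmax_l | intros; apply Hx |].
      intros s Hs. generalize (Hinc s ltac:(lra)). lra. }
    lra. }
  exists T. intros t0 Ht0. apply Rnot_le_lt. intros Hvt0.
  assert (Hstay := Hbarrier (m / 2) t0 ltac:(lra) ltac:(lra) Hvt0).
  (* at rate [d], the time needed to climb from [- m / 2] to [0] *)
  set (t1 := t0 + m / (2 * d)).
  assert (Ht1 : t0 <= t1).
  { unfold t1. assert (0 < m / (2 * d)) by (apply Rdiv_lt_0_compat; lra). lra. }
  assert (Hgrow : d * (t1 - t0) <= v t1 - v t0).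
  { apply derive_growth with
      (fun t => (a - v t) * (m + v t) - exp (P * x t) - exp (Q * (x t - g * t)));
      [assumption | intros; apply Hv |].
    intros s Hs. generalize (HFd s ltac:(lra)) (Hstay s ltac:(lra)) (Hneg s ltac:(lra)).
    unfold d. nra. }
  replace (d * (t1 - t0)) with (m / 2) in Hgrow by (unfold t1; field; lra).
  generalize (Hneg t1 ltac:(lra)). lra.
Qed.

(** The quantity [x + m t] increases, at the rate [y = m + v], so it is enough to
    bound it.  Up to the forcing [X + Y], [y' = (a - v) y >= a y]; and as [v] is
    below [- m / 2], the forcing is at most [- (2 / m) (X / P + Y / Q)'].
    Hence [a y] is at most the derivative of the bounded function
    [v - (2 / m) (X / P + Y / Q)]. *)
Lemma extinction_rate (a m P Q g : R) (x v : R -> R) :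
  0 < a -> 0 < m -> 0 < P -> 0 < Q -> 0 < g ->
  emden_fowler_flow a m P Q g x v ->
  is_lim (fun t => exp (x t)) p_infty 0 ->
  exists l : R, is_lim (fun t => x t + m * t) p_infty l.
Proof.
  intros Ha Hm HP HQ Hg Hflow Hw.
  destruct (velocity_eventually_negative a m P Q g x v) as [T HT]; auto.
  assert (Hb := velocity_bounds a m P Q g x v Ha Hm Hflow).
  destruct Hflow as [Hx Hv].
  set (X := fun t => exp (P * x t)).
  set (Y := fun t => exp (Q * (x t - g * t))).
  set (f := fun t => v t - 2 / m * (X t / P + Y t / Q) - a * (x t + m * t)).
  set (df := fun t => (a - v t) * (m + v t) - X t - Y t
     - 2 / m * (v t * X t + (v t - g) * Y t) - a * (v t + m)).
  assert (Hf : forall t, is_derive f t (df t)).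
  { intros t. unfold f, df, X, Y. flow_derive Hx Hv. field. lra. }
  assert (Hdf : forall t, T <= t -> 0 <= df t).
  { intros t Ht. unfold df.
    assert (HX : 0 < X t) by apply exp_pos. assert (HY : 0 < Y t) by apply exp_pos.
    replace ((a - v t) * (m + v t) - X t - Y t
        - 2 / m * (v t * X t + (v t - g) * Y t) - a * (v t + m))
      with (- v t * (m + v t) + 2 / m * ((- v t - m / 2) * X t + (- v t - m / 2 + g) * Y t))
      by (field; lra).
    specialize (HT t Ht). specialize (Hb t).
    assert (0 < 2 / m) by (apply Rdiv_lt_0_compat; lra).
    apply Rplus_le_le_0_compat; [apply Rmult_le_pos; lra |].
    apply Rmult_le_pos; [lra |].
    apply Rplus_le_le_0_compat; apply Rmult_le_pos; lra. }
  apply nondecreasing_bounded_ex_lim with T ((a - f T) / a).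
  - intros s t Hs Hst.
    enough (0 * (t - s) <= (x t + m * t) - (x s + m * s)) by lra.
    apply (derive_growth (fun t => x t + m * t) (fun t => v t + m)); [assumption | |].
    + intros r _. flow_derive Hx Hv. ring.
    + intros r _. generalize (Hb r). lra.
  - intros t Ht.
    assert (Hgrow := derive_growth f df 0 T t Ht (fun s _ => Hf s)
                       (fun s Hs => Hdf s (proj1 Hs))).
    apply Rmult_le_reg_r with a; [assumption |].
    replace ((a - f T) / a * a) with (a - f T) by (field; lra).
    assert (0 <= 2 / m * (X t / P + Y t / Q)).
    { apply Rmult_le_pos; [left; apply Rdiv_lt_0_compat; lra |].
      apply Rplus_le_le_0_compat; left; apply Rdiv_lt_0_compat; auto; apply exp_pos. }
    generalize (Hb t). unfold f in *. lra.
Qed.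

Theorem flow_dichotomy (a m P Q g : R) (x v : R -> R) :
  0 < a -> 0 < m -> a <> m -> 0 < P -> 0 < Q -> 0 < g ->
  emden_fowler_flow a m P Q g x v ->
  is_lim x p_infty (ln (a * m) / P) \/
  exists l : R, is_lim (fun t => x t + m * t) p_infty l.
Proof.
  intros Ha Hm Ham HP HQ Hg Hflow.
  destruct (equilibrium_or_extinction a m P Q g x v) as [HX | Hw]; auto.
  - left.
    apply is_lim_ext with (fun t => ln (exp (P * x t)) / P).
    { intros t. rewrite ln_exp. field. lra. }
    apply (is_lim_scal_r (fun t => ln (exp (P * x t))) (/ P) p_infty (ln (a * m))).
    apply (filterlim_comp _ _ _ (fun t => exp (P * x t)) ln
             (Rbar_locally' p_infty) (locally (a * m)) (locally (ln (a * m)))).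
    + exact HX.
    + apply @ex_derive_continuous. exists (/ (a * m)).
      apply is_derive_Reals, derivable_pt_lim_ln. now apply Rmult_lt_0_compat.
  - right. now apply (extinction_rate a m P Q g x v).
Qed.

(** * From the radial equation to the flow *)

Definition log_profile (u : R -> R) (t : R) : R := ln (u (exp t)).

(** The logarithmic derivative [r u' / u], at [r = e^t]. *)
Definition log_slope (u : R -> R) (t : R) : R :=
  exp t * Derive u (exp t) / u (exp t).

Lemma is_derive_log_profile (u : R -> R) :
  C2_on_pos u -> (forall r, 0 < r -> 0 < u r) ->
  forall t, is_derive (log_profile u) t (log_slope u t).
Proof.
  intros HC2 Hpos t. unfold log_profile, log_slope.
  assert (Hr := exp_pos t).
  destruct (HC2 _ Hr) as [Hu _]. assert (Hu0 := Hpos _ Hr).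
  auto_derive; [repeat split; assumption |].
  replace (Derive (fun s => u s) (exp t)) with (Derive u (exp t)) by reflexivity.
  field. lra.
Qed.

(** The exponent [alpha l p] is the one for which [r^2 r^l u^(p-1)] is a power of
    [r^alpha u] alone. *)
Lemma scaled_nonlinearity (l p : R) (u : R -> R) (t : R) :
  p <> 1 -> 0 < u (exp t) ->
  exp t ^ 2 * (Rpower (exp t) l * Rpower (u (exp t)) p) / u (exp t) =
  exp ((p - 1) * (alpha l p * t + log_profile u t)).
Proof.
  intros Hp Hu. unfold Rpower, log_profile.
  replace (exp t ^ 2) with (exp (2 * t))
    by (replace (2 * t) with (t + t) by ring; rewrite exp_plus; ring).
  rewrite ln_exp.
  assert (Hinv : / u (exp t) = exp (- ln (u (exp t)))).
  { now rewrite exp_Ropp, exp_ln. }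
  unfold Rdiv. rewrite Hinv, <- !exp_plus. f_equal.
  unfold alpha. field. lra.
Qed.

Lemma is_derive_log_slope (n : nat) (l1 l2 p q : R) (u : R -> R) :
  p <> 1 -> q <> 1 ->
  positive_radial_solution n l1 l2 p q u ->
  forall t, is_derive (log_slope u) t
    (- (log_slope u t ^ 2 + (INR n - 2) * log_slope u t
        + exp ((p - 1) * (alpha l1 p * t + log_profile u t))
        + exp ((q - 1) * (alpha l2 q * t + log_profile u t)))).
Proof.
  intros Hp Hq [HC2 [Hpos Heq]] t.
  assert (Hr := exp_pos t).
  destruct (HC2 _ Hr) as [Hu [Hdu _]]. assert (Hu0 := Hpos _ Hr).
  rewrite <- !scaled_nonlinearity by assumption.
  specialize (Heq _ Hr).
  unfold log_slope.
  auto_derive; [repeat split; try assumption; lra |].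
  change (Derive (fun s => u s) (exp t)) with (Derive u (exp t)).
  change (Derive (fun s => Derive u s) (exp t)) with (Derive_n u 2 (exp t)).
  replace (Derive_n u 2 (exp t)) with
    (- ((INR n - 1) / exp t * Derive u (exp t)
       + Rpower (exp t) l1 * Rpower (u (exp t)) p
       + Rpower (exp t) l2 * Rpower (u (exp t)) q)) by lra.
  field. split; lra.
Qed.

Lemma flow_at_infinity (n : nat) (l1 l2 p q : R) (u : R -> R) :
  p <> 1 -> q <> 1 ->
  positive_radial_solution n l1 l2 p q u ->
  emden_fowler_flow (alpha l1 p) (INR n - 2 - alpha l1 p) (p - 1) (q - 1)
    (alpha l1 p - alpha l2 q)
    (fun t => alpha l1 p * t + log_profile u t)
    (fun t => alpha l1 p + log_slope u t).
Proof.
  intros Hp Hq Hsol.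
  assert (HL := is_derive_log_profile u (proj1 Hsol) (proj1 (proj2 Hsol))).
  assert (HS := is_derive_log_slope n l1 l2 p q u Hp Hq Hsol).
  split; intros t.
  - flow_derive HL HS. ring.
  - flow_derive HL HS.
    replace (alpha l1 p * t + log_profile u t + - ((alpha l1 p + - alpha l2 q) * t))
      with (alpha l2 q * t + log_profile u t) by ring.
    ring.
Qed.

(** The reversal of time turns [v] into [- v] and hence exchanges the roots of the
    quadratic part: the exponent [alpha l2 q] of the term that dominates at the
    origin takes the place of [m]. *)
Lemma flow_at_origin (n : nat) (l1 l2 p q : R) (u : R -> R) :
  p <> 1 -> q <> 1 ->
  positive_radial_solution n l1 l2 p q u ->
  emden_fowler_flow (INR n - 2 - alpha l2 q) (alpha l2 q) (q - 1) (p - 1)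
    (alpha l1 p - alpha l2 q)
    (fun t => - alpha l2 q * t + log_profile u (- t))
    (fun t => - alpha l2 q - log_slope u (- t)).
Proof.
  intros Hp Hq Hsol.
  assert (HL := is_derive_log_profile u (proj1 Hsol) (proj1 (proj2 Hsol))).
  assert (HS := is_derive_log_slope n l1 l2 p q u Hp Hq Hsol).
  split; intros t.
  - flow_derive HL HS. ring.
  - flow_derive HL HS.
    replace (- alpha l2 q * t + log_profile u (- t) + - ((alpha l1 p + - alpha l2 q) * t))
      with (alpha l1 p * - t + log_profile u (- t)) by ring.
    replace (alpha l2 q * - t) with (- alpha l2 q * t) by ring.
    ring.
Qed.

Lemma filterlim_exp_comp (F : (R -> Prop) -> Prop) (FF : Filter F)
  (f y tau : R -> R) (l : R) :
  filterlim tau F (Rbar_locally' p_infty) ->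
  is_lim y p_infty l ->
  F (fun r => exp (y (tau r)) = f r) ->
  filterlim f F (locally (exp l)).
Proof.
  intros Htau Hy Hf.
  apply (filterlim_ext_loc (fun r => exp (y (tau r)))); [assumption |].
  apply (filterlim_comp _ _ _ tau (fun t => exp (y t)) F (Rbar_locally' p_infty));
    [assumption |].
  apply (filterlim_comp _ _ _ y exp (Rbar_locally' p_infty) (locally l)); [exact Hy |].
  apply @ex_derive_continuous. exists (exp l). apply is_derive_exp.
Qed.

Lemma is_lambda_exp (n : nat) (l p lambda : R) :
  p <> 1 -> is_lambda n l p lambda ->
  exp (ln (alpha l p * (INR n - 2 - alpha l p)) / (p - 1)) = lambda.
Proof.
  intros Hp [Hpos Hpow]. rewrite <- Hpow. unfold Rpower. rewrite ln_exp.
  replace ((p - 1) * ln lambda / (p - 1)) with (ln lambda) by (field; lra).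
  now apply exp_ln.
Qed.

Lemma Rpower_mult_exp (b : R) (u : R -> R) (r : R) :
  0 < r -> 0 < u r ->
  exp (b * ln r + log_profile u (ln r)) = Rpower r b * u r.
Proof.
  intros Hr Hu. unfold Rpower, log_profile.
  rewrite exp_plus, (exp_ln r Hr), (exp_ln (u r) Hu). reflexivity.
Qed.

Theorem theorem1 (n : nat) (l1 l2 p q lambda1 lambda2 : R) (u : R -> R)
  (hn : (3 <= n)%nat)
  (hl2 : -2 < l2) (hl12 : l2 < l1) (hl1 : l1 <= 0)
  (hp : (INR n + l1) / (INR n - 2) < p) (hpq : p < q)
  (hp_crit : p <> (INR n + 2 + 2 * l1) / (INR n - 2))
  (hq_crit : q <> (INR n + 2 + 2 * l2) / (INR n - 2))
  (hlambda1 : is_lambda n l1 p lambda1)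
  (hlambda2 : is_lambda n l2 q lambda2)
  (hu : positive_radial_solution n l1 l2 p q u) :
  (is_lim (fun r => Rpower r (alpha l1 p) * u r) p_infty lambda1 \/
   exists c1 : R, 0 < c1 /\
     is_lim (fun r => r ^ (n - 2) * u r) p_infty c1) /\
  (filterlim (fun r => Rpower r (alpha l2 q) * u r)
     (at_right 0) (locally lambda2) \/
   exists c2 : R, 0 < c2 /\ filterlim u (at_right 0) (locally c2)).
Proof.
  assert (HN : 1 <= INR n - 2).
  { assert (H3 := le_INR _ _ hn). simpl in H3. lra. }
  assert (Hpow : INR n + l1 < p * (INR n - 2)).
  { apply Rmult_lt_reg_r with (/ (INR n - 2)); [apply Rinv_0_lt_compat; lra |].
    replace (p * (INR n - 2) * / (INR n - 2)) with p by (field; lra). exact hp. }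
  assert (Hp1 : 1 < p) by nra.
  assert (Hp1' : p <> 1) by lra. assert (Hq1' : q <> 1) by lra.
  assert (Ep : alpha l1 p * (p - 1) = 2 + l1) by (unfold alpha; field; lra).
  assert (Eq : alpha l2 q * (q - 1) = 2 + l2) by (unfold alpha; field; lra).
  assert (Ha2 : 0 < alpha l2 q) by (apply Rdiv_lt_0_compat; lra).
  assert (Ha12 : alpha l2 q < alpha l1 p) by nra.
  assert (Ha1 : alpha l1 p < INR n - 2) by nra.
  assert (Hne1 : alpha l1 p <> INR n - 2 - alpha l1 p).
  { intros H. apply hp_crit. apply Rmult_eq_reg_r with (INR n - 2); [| lra].
    replace ((INR n + 2 + 2 * l1) / (INR n - 2) * (INR n - 2))
      with (INR n + 2 + 2 * l1) by (field; lra). nra. }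
  assert (Hne2 : INR n - 2 - alpha l2 q <> alpha l2 q).
  { intros H. apply hq_crit. apply Rmult_eq_reg_r with (INR n - 2); [| lra].
    replace ((INR n + 2 + 2 * l2) / (INR n - 2) * (INR n - 2))
      with (INR n + 2 + 2 * l2) by (field; lra). nra. }
  assert (Hpos := proj1 (proj2 hu)).
  split.
  - assert (Hloc : Rbar_locally' p_infty (fun r => 0 < r)) by (exists 0; auto).
    assert (Hflow := flow_at_infinity n l1 l2 p q u Hp1' Hq1' hu).
    apply flow_dichotomy in Hflow; try lra.
    destruct Hflow as [Hlim | [l Hlim]].
    + left. rewrite <- (is_lambda_exp n l1 p lambda1 Hp1' hlambda1).
      apply (filterlim_exp_comp (Rbar_locally' p_infty) _ _ _ ln _ is_lim_ln_p Hlim).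
      apply filter_imp with (2 := Hloc). intros r Hr.
      apply Rpower_mult_exp; auto.
    + right. exists (exp l). split; [apply exp_pos |].
      apply (filterlim_exp_comp (Rbar_locally' p_infty) _ _ _ ln _ is_lim_ln_p Hlim).
      apply filter_imp with (2 := Hloc). intros r Hr.
      rewrite <- (Rpower_pow (n - 2) r Hr), minus_INR by lia.
      rewrite <- Rpower_mult_exp by auto. f_equal. simpl INR. ring.
  - assert (Hloc : at_right 0 (fun r => 0 < r)).
    { exists (mkposreal 1 Rlt_0_1). auto. }
    assert (Hln : filterlim (fun r => - ln r) (at_right 0) (Rbar_locally' p_infty)).
    { apply (filterlim_comp _ _ _ ln Ropp (at_right 0) (Rbar_locally m_infty));
        [apply is_lim_ln_0 | apply (filterlim_Rbar_opp m_infty)]. }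
    assert (Hflow := flow_at_origin n l1 l2 p q u Hp1' Hq1' hu).
    apply flow_dichotomy in Hflow; try lra.
    destruct Hflow as [Hlim | [l Hlim]].
    + left. rewrite <- (is_lambda_exp n l2 q lambda2 Hq1' hlambda2).
      rewrite (Rmult_comm (alpha l2 q)).
      apply (filterlim_exp_comp (at_right 0) _ _ _ _ _ Hln Hlim).
      apply filter_imp with (2 := Hloc). intros r Hr.
      rewrite Ropp_involutive, Rmult_opp_opp.
      apply Rpower_mult_exp; auto.
    + right. exists (exp l). split; [apply exp_pos |].
      apply (filterlim_exp_comp (at_right 0) _ _ _ _ _ Hln Hlim).
      apply filter_imp with (2 := Hloc). intros r Hr.
      rewrite Ropp_involutive.
      replace (- alpha l2 q * - ln r + log_profile u (ln r) + alpha l2 q * - ln r)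
        with (log_profile u (ln r)) by ring.
      unfold log_profile. rewrite (exp_ln r Hr). apply exp_ln; auto.
Qed.
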